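(* Let $u$ be a word with domain $\mathbb{N}$ over a finite alphabet $A$. Then $u$ is uniformly recurrent if and only if the age of the labelled path $P_u$ is inexhaustible and well-quasi-ordered.
   Context: A word $u$ with domain $\mathbb{N}$ over $A$ is a sequence $(u(n))_{n\in\mathbb{N}}$ of elements of $A$. A factor of $u$ is a finite word $u(p)u(p+1)\cdots u(p+n-1)$. The word $u$ is uniformly recurrent if for every $n$ there is $m$ such that every factor of $u$ of length $n$ occurs as a factor of every factor of $u$ of length $m$. $P_u$ is the labelled graph with vertex set $\mathbb{N}$, edges $\{n,n+1\}$, and vertex $n$ labelled $u(n)$. A labelled graph $(G,\ell)$ embeds into $(G',\ell')$ if there is an embedding $h$ of $G$ onto an induced subgraph of $G'$ with $\ell'(h(v))=\ell(v)$ for all $v$. The age of a labelled graph is the class of finite labelled graphs (up to isomorphism) embedding into it, quasi-ordered by embeddability; it is well-quasi-ordered if it has no infinite antichain and no infinite strictly descending sequence. An age is inexhaustible if any two of its members embed disjointly into a third member; equivalently, for a structure $G$ with that age, deleting any finite set of vertices from $G$ does not change the age. *)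

(* Defs.v *)
From mathcomp Require Import all_boot.

Set Implicit Arguments.
Unset Strict Implicit.
Unset Printing Implicit Defensive.

Section Words.
Variable A : eqType.

Definition factor_at (u : nat -> A) (p n : nat) : seq A :=
  mkseq (fun i => u (p + i)) n.

Definition is_factor (u : nat -> A) (w : seq A) : Prop :=
  exists p, w = factor_at u p (size w).

Definition uniformly_recurrent (u : nat -> A) : Prop :=
  forall n, exists m, forall w v : seq A,
    is_factor u w -> size w = n ->
    is_factor u v -> size v = m ->
    infix w v.

End Words.

Record lgraph (A V : Type) := LGraph {
  adj : rel V;
  adj_sym : symmetric adj;
  adj_irr : irreflexive adj;
  label : V -> A
}.

Record fin_lgraph (A : Type) := FinLGraph {
  fverts : finType;
  fgraph :> lgraph A fverts
}.

Section Embeddings.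
Variable A : Type.

(* Preserving adjacency in both directions makes the image an induced
   subgraph. *)
Definition is_embedding (V W : Type) (G : lgraph A V) (H : lgraph A W)
    (h : V -> W) : Prop :=
  [/\ injective h,
      forall x y, adj H (h x) (h y) = adj G x y
    & forall x, label H (h x) = label G x].

Definition embeds (V W : Type) (G : lgraph A V) (H : lgraph A W) : Prop :=
  exists h : V -> W, is_embedding G H h.

Definition fin_embeds (F1 F2 : fin_lgraph A) : Prop := embeds F1 F2.

(* Members are representatives rather than isomorphism classes; all the
   notions below are invariant under isomorphism. *)
Definition age (V : Type) (G : lgraph A V) (F : fin_lgraph A) : Prop :=
  embeds F G.

Definition inexhaustible (C : fin_lgraph A -> Prop) : Prop :=
  forall F1 F2, C F1 -> C F2 ->
  exists F3, C F3 /\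
    exists (h1 : fverts F1 -> fverts F3) (h2 : fverts F2 -> fverts F3),
      [/\ is_embedding F1 F3 h1, is_embedding F2 F3 h2
        & forall x y, h1 x <> h2 y].

End Embeddings.

Section WellQuasiOrder.
Variables (T : Type) (C : T -> Prop) (le : T -> T -> Prop).

Definition has_infinite_antichain : Prop :=
  exists f : nat -> T,
    (forall i, C (f i)) /\ (forall i j, i <> j -> ~ le (f i) (f j)).

Definition has_infinite_descent : Prop :=
  exists f : nat -> T,
    (forall i, C (f i)) /\
    (forall i, le (f i.+1) (f i) /\ ~ le (f i) (f i.+1)).

Definition well_quasi_ordered : Prop :=
  ~ has_infinite_antichain /\ ~ has_infinite_descent.

End WellQuasiOrder.

Definition path_adj : rel nat := fun m n => (n == m.+1) || (m == n.+1).

Lemma path_adj_sym : symmetric path_adj.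
Proof. by move=> m n; rewrite /path_adj orbC. Qed.

Lemma path_adj_irr : irreflexive path_adj.
Proof. by move=> n; rewrite /path_adj -[n in n == _]addn0 -addn1 eqn_add2l. Qed.

Definition labelled_path (A : Type) (u : nat -> A) : lgraph A nat :=
  LGraph path_adj_sym path_adj_irr u.

(* Main.v *)
Require Import Defs.
From mathcomp Require Import all_boot.
From mathcomp Require Import zify boolp.

Set Implicit Arguments.
Unset Strict Implicit.
Unset Printing Implicit Defensive.

(** If [u] is uniformly recurrent and [F] is in the age, long factors of [u]
    all contain a copy of [F]; so the members of the age not above [F] are
    disjoint unions of paths of bounded length, i.e. multisets over a finite
    set, and Dickson's lemma applies.  Conversely, if a factor [w] recurs with
    unbounded gaps, up to reversal, the segments between consecutive
    occurrences of [w] form an antichain.  Finally, if every factor recurs with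
    bounded gaps up to reversal but long factors avoid [w], then they contain
    the reversal of [w], hence some factor of [u] contains both [w] and its
    reversal; such a factor or its reversal, and in both cases [w], occurs in
    every long factor. *)

(** * Dickson's lemma and the absence of infinite descent *)

Lemma nat_min (P : nat -> Prop) n :
  P n -> exists2 k, P k & forall j, P j -> k <= j.
Proof.
move=> Pn; have exP : exists i, `[< P i >] by exists n; apply/asboolP.
case: (ex_minnP exP) => k /asboolP Pk kmin.
by exists k => // j /asboolP; apply: kmin.
Qed.

(** Choosing successively the positions of minima of later and later tails gives nondecreasing
    values. *)
Lemma nondecreasing_subsequence (f : nat -> nat) :
  exists phi : nat -> nat, {homo phi : i j / i < j} /\
    {homo f \o phi : i j / i <= j}.
Proof.
have tail_min n : exists k, n <= k /\ forall j, n <= j -> f k <= f j.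
  have [v [k nk fk] vmin] :=
    @nat_min (fun v => exists2 k, n <= k & f k = v) (f n)
      (ex_intro2 _ _ n (leqnn n) erefl).
  by exists k; split=> // j nj; rewrite fk; apply: vmin; exists j.
have [g gP] := boolp.choice tail_min.
pose phi := fix phi k := if k is k'.+1 then g (phi k').+1 else g 0.
exists phi; split.
  apply: homo_ltn; first exact: ltn_trans.
  by move=> i /=; case: (gP (phi i).+1).
apply: homo_leq => //; first exact: leq_trans.
case=> [|i] /=.
  by case: (gP 0) => _; apply.
case: (gP (phi i).+1) => lt_i; apply; case: (gP (g (phi i).+1).+1) => *; lia.
Qed.

Lemma dickson (W : finType) (f : nat -> W -> nat) :
  exists i j, i < j /\ forall w, f i w <= f j w.
Proof.
(* Coordinates are treated one at a time, each passing to a further subsequence; the first two terms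
   then serve. *)
suff [phi [phi_lt phi_le]] : exists phi : nat -> nat, {homo phi : i j / i < j} /\
    forall w, w \in enum W -> {homo (fun i => f (phi i) w) : i j / i <= j}.
  exists (phi 0), (phi 1); split; first exact: phi_lt.
  by move=> w; apply: (phi_le w) => //; rewrite mem_enum.
elim: (enum W) => [|w s [phi [phi_lt phi_le]]]; first by exists (fun i => i); split.
have [psi [psi_lt psi_le]] := nondecreasing_subsequence (fun i => f (phi i) w).
exists (phi \o psi); split=> [i j ij|w']; first exact/phi_lt/psi_lt.
rewrite inE => /orP[/eqP-> //|w's] i j ij /=.
by apply: phi_le => //; apply: (ltnW_homo psi_lt).
Qed.

(** An injection into a set that is no larger is bijective, and its inverse is again an
    embedding. *)
Lemma fin_embeds_anti A (F G : fin_lgraph A) :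
  fin_embeds F G -> #|fverts G| <= #|fverts F| -> fin_embeds G F.
Proof.
case=> h [h_inj h_adj h_lab] cGF.
have [k hk kh] := inj_card_bij h_inj cGF.
exists k; split; first exact: can_inj kh.
  by move=> x y; rewrite -h_adj !kh.
by move=> x; rewrite -h_lab kh.
Qed.

Lemma no_infinite_descent A (C : fin_lgraph A -> Prop) :
  ~ has_infinite_descent C (@fin_embeds A).
Proof.
case=> f [_ f_desc].
have card_lt i : #|fverts (f i.+1)| < #|fverts (f i)|.
  rewrite ltnNge; apply/negP => le_i; case: (f_desc i) => emb; apply.
  exact: fin_embeds_anti.
have card_le i : #|fverts (f i)| + i <= #|fverts (f 0)|.
  by elim: i => [|i IH]; [lia | have := card_lt i; lia].
by have := card_le #|fverts (f 0)|.+1; lia.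
Qed.

Lemma bounded_fin (V : finType) (h : V -> nat) : exists N, forall x, h x < N.
Proof. by exists (\max_x h x).+1 => x; rewrite ltnS (leq_bigmax x). Qed.

(** * Runs of a set of positions *)

Section Runs.
Variables (A : finType) (u : nat -> A).
Implicit Type S : pred nat.

Definition run S s k := all S (iota s k).

Lemma runP S s k : reflect (forall i, i < k -> S (s + i)) (run S s k).
Proof.
apply: (iffP allP) => [H i ik|H x]; first by apply: H; rewrite mem_iota; lia.
by rewrite mem_iota => xP; have := H (x - s); rewrite subnKC; [apply; lia | lia].
Qed.

(** Left end of the run of [S] through [x]. Membership of [x] itself is not tested, so the value has
    this meaning only when [S x] holds. *)
Fixpoint run_start S x :=
  if x is y.+1 then if S y then run_start S y else x else 0.

Lemma run_start_le S x : run_start S x <= x.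
Proof. by elim: x => //= x IH; case: ifP => _; lia. Qed.

Lemma run_startP S x : S x -> run S (run_start S x) (x - run_start S x).+1.
Proof.
elim: x => [|x IH] Sx; first by rewrite /run /= Sx.
rewrite /=; case: ifP => [Sx'|_]; last by rewrite subnn /run /= Sx.
have le_x := run_start_le S x; apply/runP => i i_lt.
case: (eqVneq i (x.+1 - run_start S x)) => [->|ne_i]; first by rewrite subnKC //; lia.
by move/runP: (IH Sx') => H; apply: H; lia.
Qed.

Definition is_start S s := S s && (run_start S s == s).

Lemma run_start_is_start S x : S x -> is_start S (run_start S x).
Proof.
move=> Sx; apply/andP; split.
  by move/runP: (run_startP Sx) => /(_ 0 isT); rewrite addn0.
by elim: x Sx => //= x IH Sx; case: ifP => [/IH //|Sx'] /=; rewrite Sx'.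
Qed.

Lemma run_start_add S s i :
  is_start S s -> run S s i.+1 -> run_start S (s + i) = s.
Proof.
case/andP=> _ /eqP st_s /runP; elim: i => [|i IH] H; first by rewrite addn0.
by rewrite addnS /= (H i) // IH // => j lt_j; apply: H; lia.
Qed.

(* The word carried by the run starting at [s], padded with [None]. *)
Definition run_type m S s : {ffun 'I_m -> option A} :=
  [ffun i : 'I_m => if run S s i.+1 then Some (u (s + i)) else None].

Lemma run_type_eq m S S' s s' i : run_type m S s = run_type m S' s' ->
  i < m -> run S s i.+1 -> run S' s' i.+1 /\ u (s' + i) = u (s + i).
Proof.
move=> /ffunP/[swap] im /(_ (Ordinal im)); rewrite !ffunE /= => + r_s.
by rewrite r_s; case: ifP => // _ [->].
Qed.

(** The bound [N] makes the starts a finite list, so that they can be counted and ranked. *)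
Definition starts m N S (t : {ffun 'I_m -> option A}) :=
  [seq s <- iota 0 N | is_start S s && (run_type m S s == t)].

(* Starts of runs are matched type by type, according to their rank. *)
Lemma runs_embed m N S S' :
  (forall s, ~~ run S s m) -> (forall x, S x -> x < N) ->
  (forall t : {ffun 'I_m -> option A}, size (starts N S t) <= size (starts N S' t)) ->
  exists g : nat -> nat, [/\ forall x, S x -> S' (g x),
    forall x y, S x -> S y -> g x = g y -> x = y,
    forall x y, S x -> S y -> path_adj (g x) (g y) = path_adj x y
  & forall x, S x -> u (g x) = u x].
Proof.
move=> no_run bS le_sz.
pose ty := run_type m S.
pose sg s := nth 0 (starts N S' (ty s)) (index s (starts N S (ty s))).
have mem_st s : is_start S s -> s \in starts N S (ty s).
  by move=> st_s; rewrite mem_filter st_s eqxx mem_iota /= bS //; case/andP: st_s.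
have sgP s : is_start S s -> is_start S' (sg s) /\ run_type m S' (sg s) = ty s.
  move/mem_st; rewrite -index_mem => lt_s.
  have: sg s \in starts N S' (ty s).
    by apply: mem_nth; apply: leq_trans (le_sz _).
  by rewrite mem_filter => /andP[/andP[-> /eqP ->]].
(* Equal images have equal types, so both starts are ranked in the same list, and the target list
   has distinct entries. *)
have sg_inj s s' : is_start S s -> is_start S s' -> sg s = sg s' -> s = s'.
  move=> st_s st_s' eq_sg.
  have eq_ty : ty s = ty s'.
    by case: (sgP s st_s) => _ <-; case: (sgP s' st_s') => _ <-; rewrite eq_sg.
  have := mem_st _ st_s; have := mem_st _ st_s'.
  move: eq_sg; rewrite /sg -eq_ty => eq_nth ms' ms.
  have us' : uniq (starts N S' (ty s)) by rewrite filter_uniq ?iota_uniq.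
  move/eqP: eq_nth; rewrite nth_uniq //;
    try by apply: leq_trans (le_sz _); rewrite index_mem.
  by move/eqP => eq_ix; rewrite -(nth_index 0 ms) eq_ix nth_index.
(* Each run is translated rigidly along with its start. *)
pose st := run_start S; pose g x := sg (st x) + (x - st x).
have gP x : S x -> [/\ S' (g x), run_start S' (g x) = sg (st x) & u (g x) = u x].
  move=> Sx; have st_x := run_start_is_start Sx; have r_x := run_startP Sx.
  have [st_sg ty_sg] := sgP _ st_x.
  have lt_m : x - st x < m.
    rewrite ltnNge; apply/negP => le_m; case/negP: (no_run (st x)).
    by apply/runP => i i_lt; move/runP: r_x; apply; rewrite /st in le_m; lia.
  have [r_gx u_gx] := run_type_eq (esym ty_sg) lt_m r_x.
  split; first by move/runP: r_gx; apply.
    exact: run_start_add.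
  by rewrite u_gx subnKC // run_start_le.
have st_eq x y : S x -> S y -> sg (st x) = sg (st y) -> st x = st y.
  by move=> Sx Sy; apply: sg_inj; exact: run_start_is_start.
(* Consecutive positions of a set lie in one run, and distinct runs have distinct matches, so no new
   adjacency arises. *)
have g_succ x y : S x -> S y -> (g y == (g x).+1) = (y == x.+1).
  move=> Sx Sy; apply/eqP/eqP => [eq_g|eq_y].
    have [S'x stx _] := gP x Sx; have [_ sty _] := gP y Sy.
    have eq_st : st x = st y.
      by apply: st_eq => //; rewrite -stx -sty eq_g /= S'x.
    move: eq_g; rewrite /g eq_st.
    by have := run_start_le S x; have := run_start_le S y; rewrite -/(st x) -/(st y); lia.
  have eq_st : st y = st x by rewrite /st eq_y /= Sx.
  by rewrite /g eq_st eq_y; have := run_start_le S x; rewrite -/(st x); lia.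
exists g; split.
- by move=> x /gP[].
- move=> x y Sx Sy eq_g.
  have [_ stx _] := gP x Sx; have [_ sty _] := gP y Sy.
  have eq_st : st x = st y by apply: st_eq => //; rewrite -stx -sty eq_g.
  move: eq_g; rewrite /g eq_st.
  by have := run_start_le S x; have := run_start_le S y; rewrite -/(st x) -/(st y); lia.
- by move=> x y Sx Sy; rewrite /path_adj !g_succ.
- by move=> x /gP[].
Qed.

End Runs.

(** * Uniformly recurrent words *)

Section Word.
Variables (A : finType) (u : nat -> A).

Definition occurs p r n := forall i, i < n -> u (r + i) = u (p + i).

Lemma factor_at_eq p r n : factor_at u p n = factor_at u r n <-> occurs p r n.
Proof.
split=> [eq_f i i_lt|eq_f].
  by have := congr1 (nth (u 0) ^~ i) eq_f; rewrite !nth_mkseq.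
apply: (@eq_from_nth _ (u 0)); rewrite !size_mkseq // => i i_lt.
by rewrite !nth_mkseq // eq_f.
Qed.

Lemma infix_factor_at p q n m :
  infix (factor_at u p n) (factor_at u q m) <->
  exists r, [/\ q <= r, r + n <= q + m & occurs p r n].
Proof.
split=> [/infixP[s1 [s2 eq_v]]|[r [qr rm occ]]].
  have sz := congr1 size eq_v; rewrite !size_cat !size_mkseq in sz.
  exists (q + size s1); split; [lia | lia | move=> i i_lt].
  have := congr1 (nth (u 0) ^~ (size s1 + i)) eq_v.
  rewrite nth_mkseq; last by lia.
  rewrite nth_cat ltnNge leq_addr /= addKn nth_cat size_mkseq i_lt nth_mkseq //.
  by rewrite addnA.
have factor_cat a k l : factor_at u a (k + l) = factor_at u a k ++ factor_at u (a + k) l.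
  rewrite /factor_at /mkseq iotaD map_cat add0n; congr cat.
  rewrite -[X in iota X _]addn0 iotaDl -map_comp; apply: eq_map => i /=.
  by rewrite addnA.
have [k eq_r] : exists k, r = q + k by exists (r - q); lia.
have [l ->] : exists l, m = k + (n + l) by exists (m - k - n); lia.
apply/infixP; exists (factor_at u q k), (factor_at u (r + n) l).
by rewrite !factor_cat -eq_r; have /factor_at_eq -> := occ.
Qed.

Lemma is_factor_at p n : is_factor u (factor_at u p n).
Proof. by exists p; rewrite size_mkseq. Qed.

Lemma uniformly_recurrentP : uniformly_recurrent u <->
  forall n, exists m, forall p q, exists r, [/\ q <= r, r + n <= q + m & occurs p r n].
Proof.
split=> ur n; have [m mP] := ur n; exists m.
  by move=> p q; apply/infix_factor_at; apply: mP;
    rewrite ?size_mkseq //; exact: is_factor_at.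
move=> w v [p ->]; rewrite size_mkseq => -> [q ->]; rewrite size_mkseq => ->.
exact/infix_factor_at.
Qed.

(** The gap bound depends on [p] only through the word of length [n] read there; there are finitely
    many such words, so a maximum exists. *)
Lemma uniform_bound n :
  (forall p, exists m, forall q, exists r, [/\ q <= r, r + n <= q + m & occurs p r n]) ->
  exists m, forall p q, exists r, [/\ q <= r, r + n <= q + m & occurs p r n].
Proof.
move=> bnd.
have tup_bnd (t : n.-tuple A) : exists m, forall p, factor_at u p n = t ->
    forall q, exists r, [/\ q <= r, r + n <= q + m & occurs p r n].
  have [[p p_t]|no_p] := pselect (exists p, factor_at u p n = t); last first.
    by exists 0 => p p_t; case: no_p; exists p.
  have [m mP] := bnd p; exists m => p' p'_t q.
  have [r [qr rm /factor_at_eq occ]] := mP q.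
  exists r; split=> //; apply/factor_at_eq.
  by rewrite p'_t -p_t.
have [b bP] := boolp.choice tup_bnd.
exists (\max_t b t) => p q.
have sz : size (factor_at u p n) == n by rewrite size_mkseq.
have [r [qr rm occ]] := bP (Tuple sz) p erefl q.
by exists r; split=> //; have := leq_bigmax (F := b) (Tuple sz); lia.
Qed.

(** * Ages of labelled paths *)

(** Lets members of the age be handled as sets of positions: a suitable map from one image into the
    other is pulled back to the graphs. *)
Lemma embeds_through (F F' : fin_lgraph A) h h' (g : nat -> nat) :
  is_embedding F (labelled_path u) h -> is_embedding F' (labelled_path u) h' ->
  (forall x, g (h x) \in codom h') ->
  (forall x y, g (h x) = g (h y) -> h x = h y) ->
  (forall x y, path_adj (g (h x)) (g (h y)) = path_adj (h x) (h y)) ->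
  (forall x, u (g (h x)) = u (h x)) -> fin_embeds F F'.
Proof.
move=> [h_inj h_adj h_lab] [h'_inj h'_adj h'_lab] gm g_inj g_adj g_lab.
exists (fun x => iinv (gm x)); split.
- move=> x y eq_i; apply/h_inj/g_inj.
  by rewrite -(f_iinv (gm x)) -(f_iinv (gm y)) eq_i.
- by move=> x y; rewrite -h'_adj !f_iinv -h_adj; exact: g_adj.
- by move=> x; rewrite -h'_lab f_iinv -h_lab; exact: g_lab.
Qed.

(** Path adjacency is translation invariant, so the offset of a segment enters only its labels. *)
Definition seg_adj L : rel 'I_L := fun i j => path_adj i j.

Lemma seg_adj_sym L : symmetric (@seg_adj L).
Proof. by move=> i j; exact: path_adj_sym. Qed.

Lemma seg_adj_irr L : irreflexive (@seg_adj L).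
Proof. by move=> i; exact: path_adj_irr. Qed.

Definition seg p L : fin_lgraph A :=
  FinLGraph (LGraph (@seg_adj_sym L) (@seg_adj_irr L) (fun i => u (p + i))).

Lemma seg_embedding p L :
  is_embedding (seg p L) (labelled_path u) (fun i : 'I_L => p + i).
Proof.
split=> // [i j /addnI /val_inj //|i j].
by rewrite /= /seg_adj /path_adj -!addnS !eqn_add2l.
Qed.

Lemma age_seg p L : age (labelled_path u) (seg p L).
Proof. by exists (fun i : 'I_L => p + i); exact: seg_embedding. Qed.

(** * Consequences of uniform recurrence for the age *)

Lemma uniformly_recurrent_inexhaustible :
  uniformly_recurrent u -> inexhaustible (age (labelled_path u)).
Proof.
move=> /uniformly_recurrentP ur F1 F2 [h1 [inj1 adj1 lab1]] [h2 [inj2 adj2 lab2]].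
have [N1 N1P] := bounded_fin h1; have [N2 N2P] := bounded_fin h2.
(* The prefix of length [N2] contains the image of [h2]; its occurrence at [r], beyond the image of
   [h1], carries a disjoint copy of [F2]. *)
have [m mP] := ur N2; have [r [N1r rm occ]] := mP 0 N1.
exists (seg 0 (N1 + m)); split; first exact: age_seg.
have b1 x : h1 x < N1 + m by have := N1P x; lia.
have b2 x : r + h2 x < N1 + m by have := N2P x; lia.
exists (fun x => Ordinal (b1 x)), (fun x => Ordinal (b2 x)); split.
- split=> [x y [] /inj1 //|x y|x]; first by rewrite -adj1.
  by rewrite -lab1.
- split=> [x y [] /addnI /inj2 //|x y|x].
    by rewrite -adj2 /= /seg_adj /path_adj /= -!addnS !eqn_add2l.
  by rewrite -lab2 /= add0n occ.
- by move=> x y [] eq_xy; have := N1P x; lia.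
Qed.

Lemma uniformly_recurrent_no_antichain : uniformly_recurrent u ->
  ~ has_infinite_antichain (age (labelled_path u)) (@fin_embeds A).
Proof.
move=> /uniformly_recurrentP ur [f [f_age f_anti]].
pose h j := sval (cid (f_age j)).
have hP j : is_embedding (f j) (labelled_path u) (h j) := svalP (cid (f_age j)).
pose S j : pred nat := fun x => x \in codom (h j).
have [N0 N0P] := bounded_fin (h 0); have [m mP] := ur N0.
(* A run of length [m] would contain an occurrence of the prefix of length [N0], so [f 0] would
   embed into [f j.+1]. *)
have no_run j s : ~~ run (S j.+1) s m.
  apply/negP => /runP r_s; apply: (f_anti 0 j.+1) => //.
  have [r [sr rm occ]] := mP 0 s.
  apply: (embeds_through (g := addn r) (hP 0) (hP j.+1)).
  - move=> x; have := r_s (r + h 0 x - s); rewrite subnKC; last by lia.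
    by apply; have := N0P x; lia.
  - by move=> x y /addnI.
  - by move=> x y; rewrite /path_adj -!addnS !eqn_add2l.
  - by move=> x; rewrite occ.
have [N NP] : exists N : nat -> nat, forall j x, S j x -> x < N j.
  have bS j : exists N, forall x, S j x -> x < N.
    by have [N NP] := bounded_fin (h j); exists N => _ /codomP[x ->].
  by have [N NP] := boolp.choice bS; exists N.
pose c j (t : {ffun 'I_m -> option A}) := size (starts u (N j.+1) (S j.+1) t).
have [i [j [lt_ij le_c]]] := dickson c.
(* [runs_embed] needs one bound for both sets; raising the bound adds no starts. *)
have le_size (t : {ffun 'I_m -> option A}) :
    size (starts u (N i.+1 + N j.+1) (S i.+1) t) <=
    size (starts u (N i.+1 + N j.+1) (S j.+1) t).
  have sz k M : N k.+1 <= M -> size (starts u M (S k.+1) t) = c k t.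
    move=> le_M; rewrite /c /starts -(subnKC le_M) iotaD filter_cat size_cat.
    rewrite [X in _ + size X](_ : _ = [::]) ?addn0 //.
    apply/eqP; rewrite -(negbK (_ == _)) -has_filter; apply/hasPn => s.
    rewrite mem_iota => /andP[le_s _]; apply/negP => /andP[/andP[/NP]]; lia.
  by rewrite !sz ?leq_addr ?leq_addl.
have bS x : S i.+1 x -> x < N i.+1 + N j.+1 by move/NP; lia.
have [g [gS g_inj g_adj g_lab]] := runs_embed (no_run i) bS le_size.
have hS x : S i.+1 (h i.+1 x) by exact: codom_f.
apply: (f_anti i.+1 j.+1); first by lia.
apply: (embeds_through (g := g) (hP i.+1) (hP j.+1)) => [x|x y|x y|x].
- exact: gS.
- exact: g_inj.
- exact: g_adj.
- exact: g_lab.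
Qed.

(** * Occurrences up to reversal *)

(** Reversal is allowed because embeddings may reverse a segment. The predicate is boolean so that
    extremal copies can be chosen by [ex_minnP] and [ex_maxnP]. *)
Definition copy p q n :=
  [forall i : 'I_n, u (q + i) == u (p + i)] ||
  [forall i : 'I_n, u (q + i) == u (p + (n.-1 - i))].

Lemma copyP p q n : reflect
  (occurs p q n \/ forall i, i < n -> u (q + i) = u (p + (n.-1 - i))) (copy p q n).
Proof.
apply: (iffP orP) => -[H|H]; [left|right|left|right].
- by move=> i lt_i; exact/eqP/(forallP H (Ordinal lt_i)).
- by move=> i lt_i; exact/eqP/(forallP H (Ordinal lt_i)).
- by apply/forallP => i; apply/eqP/H.
- by apply/forallP => i; apply/eqP/H.
Qed.

Lemma copy_refl p n : copy p p n.
Proof. by apply/copyP; left. Qed.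

Lemma injective_walk L (h : nat -> nat) :
  (forall i j, i < L -> j < L -> h i = h j -> i = j) ->
  (forall i, i.+1 < L -> path_adj (h i) (h i.+1)) ->
  (forall i, i < L -> h i = h 0 + i) \/ (forall i, i < L -> h i + i = h 0).
Proof.
elim: L => [|L IH] h_inj h_adj; first by left.
have [||up|down] := IH.
- by move=> i j iL jL; apply: h_inj; lia.
- by move=> i iL; apply: h_adj; lia.
(* With at most two positions no turn is possible; from three on, turning back would revisit
   [h L]. *)
- case: L IH h_inj h_adj up => [|[|L]] _ h_inj h_adj up.
  + by left=> -[|i] // _; rewrite addn0.
  + case/orP: (h_adj 0 isT) => /eqP eq_h; [left|right] => -[|[|i]] // _; lia.
  + left=> i iL; case: (ltngtP i L.+2) => [lt_i|lt_i|->]; [exact: up|lia|].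
    case/orP: (h_adj L.+1 (ltnSn _)) => /eqP eq_h; have := up L.+1 (ltnSn _); first lia.
    have := up L (ltnW (ltnSn _)) => e1 e2.
    by have := h_inj L L.+2; lia.
- case: L IH h_inj h_adj down => [|[|L]] _ h_inj h_adj down.
  + by left=> -[|i] // _; rewrite addn0.
  + case/orP: (h_adj 0 isT) => /eqP eq_h; [left|right] => -[|[|i]] // _; lia.
  + right=> i iL; case: (ltngtP i L.+2) => [lt_i|lt_i|->]; [exact: down|lia|].
    case/orP: (h_adj L.+1 (ltnSn _)) => /eqP eq_h; have := down L.+1 (ltnSn _); last lia.
    have := down L (ltnW (ltnSn _)) => e1 e2.
    by have := h_inj L L.+2; lia.
Qed.

Lemma seg_image p L (h : 'I_L -> nat) : 0 < L ->
  is_embedding (seg p L) (labelled_path u) h ->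
  exists q, [/\ copy p q L, forall i, q <= h i < q + L
    & forall j, q <= j < q + L -> exists i, h i = j].
Proof.
case: L h => // L h _ [h_inj h_adj h_lab].
pose k i := h (inord i).
have [||up|down] := @injective_walk L.+1 k.
- move=> i j iL jL /h_inj eq_ij.
  by rewrite -(inordK iL) eq_ij inordK.
- move=> i iL; have := h_adj (inord i) (inord i.+1).
  by rewrite /= /seg_adj !inordK ?(ltnW iL) // => ->; rewrite /path_adj eqxx.
- have hE (i : 'I_L.+1) : h i = k 0 + i by rewrite -up // /k inord_val.
  exists (k 0); split.
  + apply/copyP; left=> i iL; rewrite -up // /k; have := h_lab (inord i).
    by rewrite /= inordK.
  + by move=> i; rewrite hE; have := ltn_ord i; lia.
  + by move=> j jP; exists (inord (j - k 0)); rewrite hE inordK; lia.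
- have hE (i : 'I_L.+1) : h i + i = k 0 by rewrite -(down i) // /k inord_val.
  have kL := down L (ltnSn L).
  (* A descending walk has its last vertex as left end. *)
  exists (k L); split.
  + apply/copyP; right=> i iL; have := h_lab (inord (L - i)).
    rewrite /= inordK; last by lia.
    by move=> <-; congr u; have := hE (inord (L - i)); rewrite inordK; lia.
  + by move=> i; have := hE i; have := ltn_ord i; lia.
  + move=> j jP; exists (inord (k 0 - j)).
    by have := hE (inord (k 0 - j)); rewrite inordK; lia.
Qed.

(** Reading the window backwards exchanges its two ends and reverses each of them, and [copy] is
    insensitive to reversal. *)
Lemma copy_ends p a b n L : n <= L -> copy p a n -> copy p (a + (L - n)) n ->
  copy a b L -> copy p b n /\ copy p (b + (L - n)) n.
Proof.
move=> nL ca ce /copyP[dir|rev].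
  split; apply/copyP; [case/copyP: ca => H|case/copyP: ce => H];
    [left|right|left|right] => i i_lt; rewrite -?addnA dir -?H -?addnA //; lia.
split; apply/copyP; [case/copyP: ce => H|case/copyP: ca => H];
  [right|left|right|left] => i i_lt; rewrite -?addnA rev; try lia.
- have -> : a + (L.-1 - i) = a + (L - n) + (n.-1 - i) by lia.
  by rewrite H; last lia.
- have -> : a + (L.-1 - i) = a + (L - n) + (n.-1 - i) by lia.
  by rewrite H; [congr u; lia | lia].
- have -> : a + (L.-1 - (L - n + i)) = a + (n.-1 - i) by lia.
  by rewrite H; last lia.
- have -> : a + (L.-1 - (L - n + i)) = a + (n.-1 - i) by lia.
  by rewrite H; [congr u; lia | lia].
Qed.

(* Otherwise the segment spanned by all the occurrences would be the only copy
   of itself. *)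
Lemma inexhaustible_copy p n N : 0 < n -> inexhaustible (age (labelled_path u)) ->
  exists2 q, N <= q & copy p q n.
Proof.
move=> n0 inex; apply: contrapT => no_q.
have lt_N q : copy p q n -> q <= N.
  by move=> cq; rewrite leqNgt; apply/negP => Nq; apply: no_q; exists q => //; lia.
have ex_c : exists q, copy p q n by exists p; exact: copy_refl.
case: (ex_minnP ex_c) => a ca amin.
case: (ex_maxnP ex_c lt_N) => b cb bmax.
have ab := amin b cb.
pose L := b - a + n.
have [F [[h [h_inj h_adj h_lab]] [h1 [h2 [e1 e2 disj]]]]] :=
  inex _ _ (age_seg a L) (age_seg a L).
have comp k : is_embedding (seg a L) F k ->
    is_embedding (seg a L) (labelled_path u) (h \o k).
  case=> k_inj k_adj k_lab; split=> [|x y|x]; first exact: inj_comp.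
    by rewrite -k_adj -h_adj.
  by rewrite -k_lab -h_lab.
have L0 : 0 < L by rewrite /L; lia.
(* The image is an interval whose two ends are copies, so it starts no earlier than [a] and its last
   copy is no later than [b]. Its length forces it to start at [a], so two disjoint images would
   share this vertex. *)
have pos k : is_embedding (seg a L) F k -> exists i, h (k i) = a.
  move=> /comp /(seg_image L0)[q [cq _ im]].
  have [| | | cs ce] := copy_ends (p := p) (n := n) _ _ _ cq; rewrite ?/L ?addnK //.
  - lia.
  - by rewrite subnKC.
  have := amin _ cs; have := bmax _ ce => le1 le2.
  by apply: im; rewrite /L in le1 *; lia.
have [i hi] := pos _ e1; have [j hj] := pos _ e2.
by apply: (disj i j); apply: h_inj; rewrite hi hj.
Qed.

(** Otherwise segments spanning consecutive copies, of strictly increasing length, form an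
    antichain: an embedding would send end copies to end copies. *)
Lemma bounded_gaps_copy p n : inexhaustible (age (labelled_path u)) ->
  ~ has_infinite_antichain (age (labelled_path u)) (@fin_embeds A) ->
  exists m, forall q, exists r, [/\ q <= r, r + n <= q + m & copy p r n].
Proof.
move=> inex no_anti; case: (posnP n) => [->|n0].
  exists 0 => q; exists q; split; [lia | lia |].
  by apply/copyP; left.
apply: contrapT => /forallNP no_m; apply: no_anti.
have gap m : exists ab : nat * nat, [/\ m < ab.2 - ab.1, copy p ab.1 n, copy p ab.2 n
    & forall r, ab.1 < r < ab.2 -> ~~ copy p r n].
  (* Cutting at [q + p] instead of [q] guarantees a copy to the left, namely the one at [p]; the
     extra length of the window compensates. *)
  have /existsNP[q /forallNP no_r] := no_m (m + n + p + 1).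
  have ex_b : exists b, (q + p <= b) && copy p b n.
    have [b qb cb] := inexhaustible_copy p (q + p) n0 inex.
    by exists b; rewrite qb.
  have ex_a : exists a, (a <= q + p) && copy p a n.
    by exists p; rewrite leq_addl copy_refl.
  have [a /andP[aq ca] amax] := ex_maxnP ex_a (fun i H => proj1 (andP H)).
  have [b /andP[qb cb] bmin] := ex_minnP ex_b.
  exists (a, b); split=> //= [|r rP].
  - have a_lt : a < q.
      by rewrite ltnNge; apply/negP => qa; apply: (no_r a); split=> //; lia.
    have : ~ (b + n <= q + (m + n + p + 1)) by move=> bm; apply: (no_r b); split=> //; lia.
    lia.
  - apply/negP => cr; case: (leqP r (q + p)) => [le_r|lt_r].
      by have := amax r; rewrite le_r cr => /(_ isT); lia.
    by have := bmin r; rewrite (ltnW lt_r) cr => /(_ isT); lia.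
have [ab abP] := boolp.choice gap.
pose len k := (ab k).2 - (ab k).1.
(* Since [len k] exceeds [k], iterating makes the chosen lengths [len (phi k) = phi k.+1] strictly
   increase. *)
pose phi k := iter k len 0.
have phi_lt : {homo phi : i j / i < j}.
  apply: homo_ltn; first exact: ltn_trans.
  by move=> k /=; case: (abP (phi k)).
exists (fun k => seg (ab (phi k)).1 (len (phi k) + n)); split=> [k|i j ne_ij].
  exact: age_seg.
case=> k [k_inj k_adj k_lab].
have [ni cai cbi _] := abP (phi i); have [nj caj cbj noj] := abP (phi j).
have [c_inj c_adj c_lab] := seg_embedding (ab (phi j)).1 (len (phi j) + n).
have emb : is_embedding (seg (ab (phi i)).1 (len (phi i) + n)) (labelled_path u)
    (fun x => (ab (phi j)).1 + k x).
  split=> [x y /c_inj /k_inj //|x y|x]; first by rewrite -k_adj -c_adj.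
  by rewrite -k_lab -c_lab.
have L0 : 0 < len (phi i) + n by lia.
have [r [cr rng im]] := seg_image L0 emb.
have [| | | cs ce] := copy_ends (p := p) (n := n) _ _ _ cr; rewrite ?addnK //.
- lia.
- by rewrite /len subnKC //; lia.
have bnd y : r <= y < r + (len (phi i) + n) ->
    (ab (phi j)).1 <= y < (ab (phi j)).1 + (len (phi j) + n).
  by move=> /im[x <-]; have := ltn_ord (k x); lia.
have b1 := bnd r; have b2 := bnd (r + (len (phi i) + n)).-1.
rewrite addnK in ce.
(* Segment [j] contains copies only at its two ends, so the two end copies of the image must be
   these. *)
have len_eq : len (phi i) = len (phi j).
  have := contraL (noj r) cs; have := contraL (noj (r + len (phi i))) ce.
  rewrite /len in b1 b2 *; lia.
have : phi i.+1 = phi j.+1 by [].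
case: (ltngtP i j) => [lt_ij|lt_ji|//].
  by have := phi_lt i.+1 j.+1 lt_ij; lia.
by have := phi_lt j.+1 i.+1 lt_ji; lia.
Qed.

Lemma bounded_gaps_occurs :
  (forall p n, exists m, forall q, exists r, [/\ q <= r, r + n <= q + m & copy p r n]) ->
  forall p n, exists m, forall q, exists r, [/\ q <= r, r + n <= q + m & occurs p r n].
Proof.
move=> bnd p n; apply: contrapT => /forallNP no_m.
have [m0 m0P] := bnd p n.
have /existsNP[q0 /forallNP no_r0] := no_m m0.
have [r0 [q0r r0m /copyP[occ|rev0]]] := m0P q0; first by apply: (no_r0 r0).
(* The least window containing the word at [p] and its reversal at [r0]. *)
pose s := minn p r0; pose e := maxn p r0 + n.
have [m1 m1P] := bnd s (e - s).
have /existsNP[q1 /forallNP no_r1] := no_m m1.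
have [r1 [q1r r1m /copyP[dir|rev]]] := m1P q1.
  apply: (no_r1 (r1 + (p - s))); split; [lia | rewrite /s /e in r1m *; lia |].
  move=> i i_lt; rewrite -addnA dir; first by congr u; rewrite /s; lia.
  by rewrite /s /e; lia.
(* In a reversed copy of the window, the mirror image of the block at [r0] reads as the word at
   [p]. *)
apply: (no_r1 (r1 + (e - r0 - n))); split; [lia | rewrite /s /e in r1m *; lia |].
move=> i i_lt; rewrite -addnA rev; last by rewrite /s /e; lia.
have -> : s + ((e - s).-1 - (e - r0 - n + i)) = r0 + (n.-1 - i) by rewrite /s /e; lia.
by rewrite rev0; [congr u; lia | lia].
Qed.

End Word.

Theorem theorem6 (A : finType) (u : nat -> A) :
  uniformly_recurrent u <->
  (inexhaustible (age (labelled_path u)) /\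
   well_quasi_ordered (age (labelled_path u)) (@fin_embeds A)).
Proof.
split=> [ur|[inex [no_anti _]]].
  split; first exact: uniformly_recurrent_inexhaustible.
  split; [exact: uniformly_recurrent_no_antichain | exact: no_infinite_descent].
apply/uniformly_recurrentP => n; apply: uniform_bound => p.
by apply: bounded_gaps_occurs => p' n'; exact: bounded_gaps_copy.
Qed.
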